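(* Let $\mathbf{A} \in \mathbb{R}^{n\times n}$ be invertible and let $\hat{\mathbf{A}}$ be a random $n\times n$ real matrix, invertible almost surely, such that $\mathbb{E}[\hat{\mathbf{A}}^{-2}]$ exists. Suppose the distribution of $\hat{\mathbf{A}}$ is symmetric about its mean (i.e. $\hat{\mathbf{A}} - \mathbf{A}$ and $\mathbf{A} - \hat{\mathbf{A}}$ have the same distribution) and $\mathbb{E}[\hat{\mathbf{A}}] = \mathbf{A}$. Let $\mathbf{b} \in \mathbb{R}^n$ be a random vector, independent of $\hat{\mathbf{A}}$, with nonsingular auto-correlation matrix $\mathbf{R} = \mathbb{E}[\mathbf{b}\mathbf{b}^T]$. For $\beta \in \mathbb{R}$ define the augmented inverse operator $$\tilde{\mathbf{A}}_\beta^{-1} = \hat{\mathbf{A}}^{-1} - \beta\hat{\mathbf{A}}^{-1}\mathbf{R}^{-1}$$ and the semi-Bayesian residual error $$E(\beta) = \mathbb{E}_{\mathbf{b}}\mathbb{E}_{\hat{\mathbf{A}}}\big[\|\tilde{\mathbf{A}}_\beta^{-1}\mathbf{b} - \mathbf{A}^{-1}\mathbf{b}\|^2_{\mathbf{A}^T\mathbf{A}}\big] = \mathbb{E}_{\hat{\mathbf{A}}}\big[\|\tilde{\mathbf{A}}_\beta^{-1} - \mathbf{A}^{-1}\|^2_{\mathbf{A}^T\mathbf{A},\mathbf{R}}\big].$$ Then the optimal augmentation factor $\beta^* = \arg\min_\beta E(\beta)$ is nonnegative.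
   Context: For a vector $\mathbf{v}$ and symmetric positive definite $\mathbf{B}$, $\|\mathbf{v}\|_{\mathbf{B}}^2 = \mathbf{v}^T\mathbf{B}\mathbf{v}$. For matrices, $\langle \mathbf{M}, \mathbf{N}\rangle_{\mathbf{B},\mathbf{R}} = \mathrm{tr}(\mathbf{R}^{1/2}\mathbf{M}^T\mathbf{B}\mathbf{N}\mathbf{R}^{1/2})$ and $\|\mathbf{M}\|_{\mathbf{B},\mathbf{R}}^2 = \langle \mathbf{M},\mathbf{M}\rangle_{\mathbf{B},\mathbf{R}}$. The minimizer of the quadratic $E(\beta)$ is $\beta^* = \mathbb{E}\langle \hat{\mathbf{K}}, \hat{\mathbf{A}}^{-1} - \mathbf{A}^{-1}\rangle_{\mathbf{A}^T\mathbf{A},\mathbf{R}} / \mathbb{E}\|\hat{\mathbf{K}}\|^2_{\mathbf{A}^T\mathbf{A},\mathbf{R}}$ with $\hat{\mathbf{K}} = \hat{\mathbf{A}}^{-1}\mathbf{R}^{-1}$. *)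

(* Defs.v *)
From HB Require Import structures.
From mathcomp Require Import all_boot all_order all_algebra.
From mathcomp Require Import all_classical all_reals all_analysis.
Set Implicit Arguments. Unset Strict Implicit. Unset Printing Implicit Defensive.
Import Order.TTheory GRing.Theory Num.Theory.
Import numFieldNormedType.Exports.
Local Open Scope classical_set_scope.
Local Open Scope ring_scope.

Definition mx_borel (R : realType) (m n : nat) : set (set 'M[R]_(m, n)) :=
  <<s [set U : set 'M[R]_(m, n) | open U] >>.

Definition random_mx d (T : measurableType d) (R : realType) (m n : nat)
  (X : T -> 'M[R]_(m, n)) : Prop :=
  forall B, mx_borel B -> measurable (X @^-1` B).

Definition same_distr d (T : measurableType d) (R : realType) (m n : nat)
  (P : probability T R) (X Y : T -> 'M[R]_(m, n)) : Prop :=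
  forall B, mx_borel B -> P (X @^-1` B) = P (Y @^-1` B).

Definition indep_mx d (T : measurableType d) (R : realType) (m n p q : nat)
  (P : probability T R) (X : T -> 'M[R]_(m, n)) (Y : T -> 'M[R]_(p, q)) : Prop :=
  forall B C, mx_borel B -> mx_borel C ->
    P (X @^-1` B `&` Y @^-1` C) = (P (X @^-1` B) * P (Y @^-1` C))%E.

Definition autocorr d (T : measurableType d) (R : realType) (n : nat)
  (P : probability T R) (b : T -> 'cV[R]_n) : 'M[R]_n :=
  \matrix_(i, j) fine 'E_P[(fun w => b w i 0 * b w j 0)%R].

Definition wnorm2 (R : realType) (n : nat) (B : 'M[R]_n) (v : 'cV[R]_n) : R :=
  (v^T *m B *m v) 0 0.

Definition aug_inv (R : realType) (n : nat) (Ahat Rm : 'M[R]_n) (beta : R)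
  : 'M[R]_n :=
  invmx Ahat - beta *: (invmx Ahat *m invmx Rm).

(* semi-Bayesian residual error E(beta) = E_b E_Ahat ||..||^2_{A^T A}
   (joint expectation over the probability space; b and Ahat independent) *)
Definition semiBayes_err d (T : measurableType d) (R : realType) (n : nat)
  (P : probability T R) (A : 'M[R]_n) (Ahat : T -> 'M[R]_n)
  (b : T -> 'cV[R]_n) (beta : R) : \bar R :=
  'E_P[(fun w => wnorm2 (A^T *m A)
      ((aug_inv (Ahat w) (autocorr P b) beta - invmx A) *m b w))%R].

(* Main.v *)
Require Import Defs.
From HB Require Import structures.
From mathcomp Require Import all_boot all_order all_algebra.
From mathcomp Require Import all_classical all_reals all_analysis.
From mathcomp Require Import measurable_realfun ring lra.
Import Order.TTheory GRing.Theory Num.Theory.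
Import numFieldNormedType.Exports.
Local Open Scope classical_set_scope.
Local Open Scope ring_scope.

(** With [M = A Ahat^-1], [u = (M - 1) b] and [v = M R^-1 b], the residual error
    is [E(beta) = E|u|^2 - 2 beta E<v, u> + beta^2 E|v|^2], where [E|v|^2 > 0]
    because [b] is not almost surely zero.  By independence
    [E<v, u> = E tr (M^T (M - 1))].  Symmetry of the law pairs [Ahat] with
    [2 A - Ahat], for which [M' = A (2 A - Ahat)^-1] satisfies
    [M + M' = 2 M M']; hence [tr M + tr M' = 2 tr (M M') <= |M|^2 + |M'|^2] and
    [E<v, u> >= 0].  Since [M] is not known a priori to be square integrable,
    the last two steps are carried out on events, invariant under
    [Ahat -> 2 A - Ahat], where the matrix of the form [<v, u>] is bounded, and
    dominated convergence concludes. *)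

(** * Measurability of matrix-valued maps *)

Lemma measurable_invr (R : realType) :
  measurable_fun [set: R] (fun x : R => x^-1).
Proof.
(* The real power needs a nonnegative base, hence the detour through [x ^+ 2]; at [0] both sides
   vanish because [0^-1 = 0]. *)
have -> : (fun x : R => x^-1) = (fun x => x * (x ^+ 2) `^ (-1)).
  apply/funext => x; rewrite powR_inv1 ?sqr_ge0//.
  by have [->|x0] := eqVneq x 0; [rewrite invr0 mul0r|field].
apply: measurable_funM => //.
apply: (measurableT_comp (measurable_powR _)).
exact: measurable_funX.
Qed.

Definition measurable_mx {d} {T : measurableType d} {R : realType} {m n : nat}
    (F : T -> 'M[R]_(m, n)) : Prop :=
  forall i j, measurable_fun [set: T] (fun t => F t i j).

Section measurable_matrices.
Context {d} {T : measurableType d} {R : realType}.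

Lemma measurable_mx_cst m n (A : 'M[R]_(m, n)) :
  measurable_mx (fun _ : T => A).
Proof. by move=> i j; exact: measurable_cst. Qed.

Lemma measurable_mxD m n (F G : T -> 'M[R]_(m, n)) :
  measurable_mx F -> measurable_mx G -> measurable_mx (fun t => F t + G t).
Proof.
move=> mF mG i j; under eq_fun do rewrite mxE.
by apply: measurable_funD.
Qed.

Lemma measurable_mxB m n (F G : T -> 'M[R]_(m, n)) :
  measurable_mx F -> measurable_mx G -> measurable_mx (fun t => F t - G t).
Proof.
move=> mF mG i j; under eq_fun do rewrite !mxE.
by apply: measurable_funB.
Qed.

Lemma measurable_trmx m n (F : T -> 'M[R]_(m, n)) :
  measurable_mx F -> measurable_mx (fun t => (F t)^T).
Proof. by move=> mF i j; under eq_fun do rewrite mxE; exact: mF. Qed.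

Lemma measurable_mulmx m n p (F : T -> 'M[R]_(m, n)) (G : T -> 'M[R]_(n, p)) :
  measurable_mx F -> measurable_mx G -> measurable_mx (fun t => F t *m G t).
Proof.
move=> mF mG i j; under eq_fun do rewrite mxE.
by apply: measurable_sum => k; exact: measurable_funM.
Qed.

Lemma measurable_det n (F : T -> 'M[R]_n) :
  measurable_mx F -> measurable_fun [set: T] (fun t => \det (F t)).
Proof.
move=> mF; apply: measurable_sum => s.
by apply: measurable_funM => //; apply: measurable_prod.
Qed.

Lemma measurable_unitmx n (F : T -> 'M[R]_n) :
  measurable_mx F -> measurable_fun [set: T] (fun t => F t \in unitmx).
Proof.
move=> /measurable_det mF.
rewrite (_ : (fun t => _) = (fun t => ~~ (\det (F t) == 0))).
  by apply: measurable_neg; exact: measurable_fun_eqr.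
by apply/funext => t; rewrite unitmxE unitfE.
Qed.

Lemma measurable_invmx n (F : T -> 'M[R]_n) :
  measurable_mx F -> measurable_mx (fun t => invmx (F t)).
Proof.
move=> mF i j.
(* On units this is the adjugate formula; elsewhere [invmx] returns its argument. *)
rewrite (_ : (fun t => _) = (fun t => if F t \in unitmx
    then (\det (F t))^-1 * ((-1) ^+ (j + i) * \det (row' j (col' i (F t))))
    else F t i j)).
  apply: measurable_fun_ifT => //; first exact: measurable_unitmx.
  apply: measurable_funM.
    by apply: (measurableT_comp (@measurable_invr R)); exact: measurable_det.
  apply: measurable_funM => //; apply: measurable_det => k l.
  by under eq_fun do rewrite !mxE; exact: mF.
by apply/funext => t; rewrite /invmx; case: ifP => _ //; rewrite !mxE.
Qed.

End measurable_matrices.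

(** * The Borel sigma-algebra on matrices *)

Definition borel_mx (R : realType) (m n : nat) : measurableType _ :=
  g_sigma_algebraType [set U : set 'M[R]_(m, n) | open U].

(** Coordinates are continuous, so they pull open intervals back to generators. Feeding [id] to the
    stability lemmas for [measurable_mx] then gives measurability of functions of the matrix itself,
    as needed to apply hypotheses on laws. *)
Lemma measurable_mx_borel (R : realType) (m n : nat) :
  measurable_mx (T := borel_mx R m n) id.
Proof.
move=> i j; pose f (Z : borel_mx R m n) := (Z : 'M[R]_(m, n)) i j.
apply: (@measurability _ _ _ _ _ f _ (RGenOpens.measurableE R)).
move=> _ [_ [x [y ->]] <-]; apply: sub_sigma_algebra; rewrite setTI /=.
have /continuousP : continuous (fun Z : 'M[R]_(m, n) => Z i j).
  exact: coord_continuous.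
by apply; exact: interval_open.
Qed.

Lemma random_mxP d (T : measurableType d) (R : realType) (m n : nat)
    (X : T -> 'M[R]_(m, n)) :
  random_mx X <-> measurable_fun [set: T] (X : T -> borel_mx R m n).
Proof.
split=> mX; first by move=> _ B mB; rewrite setTI; exact: mX.
by move=> B mB; rewrite -[X in measurable X]setTI; exact: mX.
Qed.

Lemma random_mx_measurable d (T : measurableType d) (R : realType) (m n : nat)
    (X : T -> 'M[R]_(m, n)) :
  random_mx X -> measurable_mx X.
Proof.
move=> /random_mxP mX i j.
exact: (measurableT_comp (@measurable_mx_borel R m n i j) mX).
Qed.

Lemma ge0_fin_num_integrable d (T : measurableType d) (R : realType)
    (mu : {measure set T -> \bar R}) (f : T -> R) :
  measurable_fun [set: T] f -> (forall x, 0 <= f x) ->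
  (\int[mu]_x (f x)%:E)%E \is a fin_num -> mu.-integrable [set: T] (EFin \o f).
Proof.
move=> mf f0 fin; apply/integrableP; split; first exact/measurable_EFinP.
under eq_integral do rewrite /= ger0_norm//.
by rewrite ltey_eq fin.
Qed.

(** * Integrals of independent and of identically distributed variables *)

Section independence.
Context {d} {T : measurableType d} {R : realType} (P : probability T R).

(** By independence the joint law of [(X, Y)] agrees with the product of the marginals on
    rectangles, hence everywhere; a change of variables and Fubini then factor the integral. *)
Lemma Rintegral_mul_indep (X Y : {mfun T >-> R}) :
  (forall B C, measurable B -> measurable C ->
    P (X @^-1` B `&` Y @^-1` C) = (P (X @^-1` B) * P (Y @^-1` C))%E) ->
  P.-integrable [set: T] (EFin \o X) -> P.-integrable [set: T] (EFin \o Y) ->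
  P.-integrable [set: T] (EFin \o (fun w => X w * Y w)) ->
  \int[P]_w (X w * Y w) = \int[P]_w X w * \int[P]_w Y w.
Proof.
move=> XYind iX iY iXY.
pose XY w := (X w, Y w).
have mXY : measurable_fun setT XY by exact: measurable_fun_pair.
pose mXYm := isMeasurableFun.Build _ _ _ _ _ mXY.
pose XYm : {mfun T >-> (R * R)%type} := HB.pack XY mXYm.
pose f (z : R * R) := (z.1 * z.2)%:E.
have mf : measurable_fun setT f.
  by apply/measurable_EFinP; exact: measurable_funM.
have lawE B : measurable B ->
    (distribution P X \x distribution P Y)%E B = distribution P XYm B.
  by apply: product_measure_unique => B1 B2 mB1 mB2; exact: XYind.
have if_ : (distribution P X \x distribution P Y)%E.-integrable setT f.
  apply/integrableP; split => //.
  rewrite (eq_measure_integral (distribution P XYm)) => [|B mB _]; last exact: lawE.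
  have /integrableP[_] // : (distribution P XYm).-integrable setT f.
  exact: (@integrable_pushforward _ _ _ _ _ XYm).
have Efin : (\int[P]_w (X w * Y w)%:E = \int[P]_w (X w)%:E * \int[P]_w (Y w)%:E)%E.
  have -> : (\int[P]_w (X w * Y w)%:E = \int[distribution P XYm]_z f z)%E.
    by rewrite (@integral_pushforward _ _ _ _ _ XYm).
  rewrite (eq_measure_integral (distribution P X \x distribution P Y)%E) => [|B mB _];
    last by apply: esym; exact: lawE.
  rewrite -integral12_prod_meas1//.
  have iYd : (distribution P Y).-integrable setT EFin.
    exact: (@integrable_pushforward _ _ _ _ _ Y).
  have iXd : (distribution P X).-integrable setT EFin.
    exact: (@integrable_pushforward _ _ _ _ _ X).
  have EY : (\int[distribution P Y]_y y%:E = \int[P]_w (Y w)%:E)%E.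
    by rewrite (@integral_pushforward _ _ _ _ _ Y).
  have EX : (\int[distribution P X]_y y%:E = \int[P]_w (X w)%:E)%E.
    by rewrite (@integral_pushforward _ _ _ _ _ X).
  under eq_integral => x _.
    rewrite /fubini_F /f /=; under eq_integral do rewrite EFinM.
    rewrite integralZl// EY.
    over.
  have : (\int[P]_w (Y w)%:E)%E \is a fin_num by exact: integrable_fin_num.
  move=> /fineK <-.
  by rewrite integralZr// EX.
by rewrite /Rintegral Efin fineM//; exact: integrable_fin_num.
Qed.

End independence.

Lemma Rintegral_same_law d (T : measurableType d) (R : realType)
    (P : probability T R) (X Y : {mfun T >-> R}) :
  (forall B, measurable B -> P (X @^-1` B) = P (Y @^-1` B)) ->
  P.-integrable [set: T] (EFin \o X) -> P.-integrable [set: T] (EFin \o Y) ->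
  \int[P]_w X w = \int[P]_w Y w.
Proof.
move=> XY iX iY; congr fine.
transitivity (\int[distribution P X]_x x%:E)%E.
  by rewrite (@integral_pushforward _ _ _ _ _ X).
transitivity (\int[distribution P Y]_x x%:E)%E.
  by apply: eq_measure_integral => B mB _; exact: XY.
by rewrite (@integral_pushforward _ _ _ _ _ Y).
Qed.

(** * The trace inequality *)

Section trace.
Context {R : realFieldType} {n : nat}.
Implicit Types A M N S Z : 'M[R]_n.

Lemma mxtrace_mul_trmx m (M N : 'M[R]_(m, n)) :
  \tr (M *m N^T) = \sum_i \sum_j M i j * N i j.
Proof.
by apply: eq_bigr => i _; rewrite mxE; apply: eq_bigr => j _; rewrite mxE.
Qed.

Lemma mxtrace_mul_trmx_ge0 M : 0 <= \tr (M *m M^T).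
Proof.
rewrite mxtrace_mul_trmx; apply: sumr_ge0 => i _; apply: sumr_ge0 => j _.
exact: sqr_ge0.
Qed.

(* The hypotheses give [M + M' = M (Y + Y') M' = 2 M M'], so the sum below is
   the squared Frobenius norm of [M^T - M']. *)
Lemma mxtrace_inverse_pair_ge0 M M' Y Y' :
  M *m Y = 1%:M -> Y' *m M' = 1%:M -> Y + Y' = 1%:M *+ 2 ->
  0 <= \tr (M^T *m (M - 1%:M)) + \tr (M'^T *m (M' - 1%:M)).
Proof.
move=> MY YM' YY'.
have MM' : M + M' = (M *m M') *+ 2.
  have : M *m (Y + Y') *m M' = M' + M.
    by rewrite mulmxDr mulmxDl MY mul1mx -mulmxA YM' mulmx1.
  by rewrite YY' !mulr2n mulmxDr mulmx1 mulmxDl (addrC M') => ->.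
have trMM' : \tr M + \tr M' = \tr (M *m M') *+ 2.
  by rewrite -raddfD MM' raddfMn.
have := mxtrace_mul_trmx_ge0 (M^T - M').
rewrite linearB /= trmxK !(mulmxBl, mulmxBr) !raddfB /= !mulmx1.
rewrite -trmx_mul !mxtrace_tr [\tr (M' *m M)]mxtrace_mulC.
rewrite [\tr (M' *m M'^T)]mxtrace_mulC.
move: trMM'; lra.
Qed.

End trace.

(** For [Z] a value of [Ahat] and [S] the inverse of the auto-correlation matrix, this is the matrix
    of the quadratic form [<v, u>] in [b]. *)
Definition cross_form {R : realType} {n : nat} (A S Z : 'M[R]_n) : 'M[R]_n :=
  (A *m invmx Z *m S)^T *m (A *m invmx Z - 1%:M).

Lemma measurable_cross_form d (T : measurableType d) (R : realType) (n : nat)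
    (A S : 'M[R]_n) (F : T -> 'M[R]_n) :
  measurable_mx F -> measurable_mx (fun t => cross_form A S (F t)).
Proof.
move=> mF; have mM : measurable_mx (fun t => A *m invmx (F t)).
  by apply: measurable_mulmx; [exact: measurable_mx_cst|exact: measurable_invmx].
apply: measurable_mulmx; last by apply: measurable_mxB.
by apply: measurable_trmx; apply: measurable_mulmx.
Qed.

(** The sum is the trace of the form times [C]. By symmetry of [C] and cyclicity of the trace, [C]
    cancels the [invmx C] inside the form, so the sign does not depend on the auto-correlation. *)
Lemma cross_form_sum (R : realType) (n : nat) (A C Z : 'M[R]_n) :
  C \in unitmx -> C^T = C ->
  \sum_i \sum_j cross_form A (invmx C) Z i j * C i j =
  \tr ((A *m invmx Z)^T *m (A *m invmx Z - 1%:M)).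
Proof.
move=> uC symC; rewrite -mxtrace_mul_trmx symC /cross_form trmx_mul trmx_inv.
by rewrite symC mxtrace_mulC !mulmxA mulmxV// mul1mx.
Qed.

Lemma cross_form_reflect_ge0 (R : realType) (n : nat) (A C Z : 'M[R]_n) :
  A \in unitmx -> C \in unitmx -> C^T = C -> Z \in unitmx ->
  A *+ 2 - Z \in unitmx ->
  0 <= \sum_i \sum_j cross_form A (invmx C) Z i j * C i j +
       \sum_i \sum_j cross_form A (invmx C) (A *+ 2 - Z) i j * C i j.
Proof.
move=> uA uC symC uZ uZ'; rewrite !cross_form_sum//.
(* Here [M = A Z^-1] and [M' = A (2 A - Z)^-1], whose inverses [Z A^-1] and [(2 A - Z) A^-1] add up
   to twice the identity. *)
apply: (@mxtrace_inverse_pair_ge0 _ _ _ _ (Z *m invmx A)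
  ((A *+ 2 - Z) *m invmx A)).
- by rewrite -mulmxA mulKmx// mulmxV.
- by rewrite -mulmxA mulKmx// mulmxV.
- by rewrite -mulmxDl addrC subrK mulr2n mulmxDl mulmxV// mulr2n.
Qed.

Lemma bounded_integrable d (T : measurableType d) (R : realType)
    (P : probability T R) (f : T -> R) (M : R) :
  measurable_fun [set: T] f -> (forall x, `|f x| <= M) ->
  P.-integrable [set: T] (EFin \o f).
Proof.
move=> mf fM; apply: (@le_integrable _ _ _ P _ _ _ (cst M%:E)) => //.
- exact/measurable_EFinP.
- by move=> x _; rewrite /= lee_fin (le_trans (fM x))// ler_norm.
- exact: finite_measure_integrable_cst.
Qed.

Lemma Rintegral_sum d (T : measurableType d) (R : realType)
    (mu : {measure set T -> \bar R}) (I : Type) (s : seq I) (f : I -> T -> R) :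
  (forall i, mu.-integrable [set: T] (EFin \o f i)) ->
  \int[mu]_x (\sum_(i <- s) f i x) = \sum_(i <- s) \int[mu]_x f i x.
Proof.
move=> intf; rewrite /Rintegral; under eq_integral do rewrite -sumEFin.
rewrite integral_sum// -sum_fine//.
by move=> i _; apply: integrable_fin_num => //; exact: intf.
Qed.

Lemma integrable_sumr d (T : measurableType d) (R : realType)
    (mu : {measure set T -> \bar R}) (I : Type) (s : seq I) (f : I -> T -> R) :
  (forall i, mu.-integrable [set: T] (EFin \o f i)) ->
  mu.-integrable [set: T] (EFin \o (fun x => \sum_(i <- s) f i x)).
Proof.
move=> intf; have := integrable_sum measurableT s (P := predT) (fun i _ => intf i).
by congr (_.-integrable _ _); apply/funext => x; rewrite /= sumEFin.
Qed.

Lemma measurable_mx_borel_preimage (R : realType) (m n : nat)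
    (g : borel_mx R m n -> R) (B : set R) :
  measurable_fun [set: borel_mx R m n] g -> measurable B ->
  mx_borel (g @^-1` B).
Proof. by move=> mg mB; have := mg measurableT B mB; rewrite setTI. Qed.

(** * Truncation to events invariant under reflection *)

Definition cross_size {R : realType} {n : nat} (A S Z : 'M[R]_n) : R :=
  \sum_i \sum_j (`|cross_form A S Z i j| +
                 `|cross_form A S (A *+ 2 - Z) i j|).

(** A real-valued indicator, to be multiplied into integrands. Treating [Z] and [A *+ 2 - Z] alike,
    here and in [cross_size], makes it invariant under reflection. *)
Definition truncation {R : realType} {n : nat} (A S : 'M[R]_n) (N : nat)
    (Z : 'M[R]_n) : R :=
  [&& Z \in unitmx, A *+ 2 - Z \in unitmx & cross_size A S Z <= N%:R]%:R.

Section truncation.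
Context {R : realType} {n : nat} (A S : 'M[R]_n).

Lemma cross_form_le_size Z i j : `|cross_form A S Z i j| <= cross_size A S Z.
Proof.
rewrite /cross_size (bigD1 i)//= (bigD1 j)//= -!addrA lerDl.
by rewrite !(addr_ge0, sumr_ge0)// => *; rewrite ?sumr_ge0// => *; rewrite addr_ge0.
Qed.

Lemma truncation_reflect N Z : truncation A S N (A *+ 2 - Z) = truncation A S N Z.
Proof.
rewrite /truncation /cross_size subKr andbCA; congr (_ && (_ && (_ <= _)))%:R.
by apply: eq_bigr => i _; apply: eq_bigr => j _; rewrite addrC.
Qed.

Lemma truncation_ge0 N Z : 0 <= truncation A S N Z.
Proof. exact: ler0n. Qed.

Lemma truncation_le1 N Z : truncation A S N Z <= 1.
Proof. by rewrite lern1 leq_b1. Qed.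

Lemma truncated_cross_form_le N Z i j :
  `|truncation A S N Z * cross_form A S Z i j| <= N%:R.
Proof.
rewrite /truncation; case: and3P => [[_ _ sN]|_]; last by rewrite mul0r normr0.
by rewrite mul1r (le_trans (cross_form_le_size _ _ _)).
Qed.

Lemma measurable_mx_reflect d (T : measurableType d) (F : T -> 'M[R]_n) :
  measurable_mx F -> measurable_mx (fun t => A *+ 2 - F t).
Proof. by move=> mF; apply: measurable_mxB => //; exact: measurable_mx_cst. Qed.

Lemma measurable_truncation d (T : measurableType d) (F : T -> 'M[R]_n) N :
  measurable_mx F -> measurable_fun [set: T] (fun t => truncation A S N (F t)).
Proof.
move=> mF; have mF' := measurable_mx_reflect _ _ _ mF.
rewrite (_ : (fun t => _) = (fun t => if [&& F t \in unitmx,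
  A *+ 2 - F t \in unitmx & cross_size A S (F t) <= N%:R] then 1 else 0)).
  apply: measurable_fun_ifT => //; apply: measurable_and.
    exact: measurable_unitmx.
  apply: measurable_and; first exact: measurable_unitmx.
  apply: measurable_fun_ler => //.
  apply: measurable_sum => i; apply: measurable_sum => j.
  by apply: measurable_funD; apply: (measurableT_comp (@normr_measurable R _));
    apply: measurable_cross_form.
by apply/funext => t; rewrite /truncation; case: ifP.
Qed.

End truncation.

(** * Nonnegativity of the expected cross term *)

Section cross_term.
Context {d} {T : measurableType d} {R : realType} (P : probability T R).
Context {n : nat} (A : 'M[R]_n) (Ahat : T -> 'M[R]_n) (b : T -> 'cV[R]_n).
Hypothesis uA : A \in unitmx.
Hypothesis rAhat : random_mx Ahat.
Hypothesis uAhat : {ae P, forall w, Ahat w \in unitmx}.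
Hypothesis symAhat : same_distr P (fun w => Ahat w - A) (fun w => A - Ahat w).
Hypothesis rb : random_mx b.
Hypothesis Ahat_b_indep : indep_mx P Ahat b.
Hypothesis intbb : forall i j,
  P.-integrable setT (fun w => (b w i 0 * b w j 0)%:E).
Hypothesis uC : autocorr P b \in unitmx.

Let C := autocorr P b.
Let K := cross_form A (invmx C).
Let chi := truncation A (invmx C).
Let mAhat : measurable_mx Ahat := random_mx_measurable _ _ _ _ _ _ rAhat.
Let mb : measurable_mx b := random_mx_measurable _ _ _ _ _ _ rb.

(** This is [<v, u>], expanded so that each summand is a function of [Ahat] times a function of [b],
    ready for independence. *)
Definition cross_term (w : T) : R :=
  \sum_i \sum_j K (Ahat w) i j * (b w i 0 * b w j 0).

(** What is left of the truncated cross term once [b] is averaged out. *)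
Let truncated_form N (Z : 'M[R]_n) : R :=
  \sum_i \sum_j (chi N Z * K Z i j) * C i j.

Let mchiK d' (T' : measurableType d') (F : T' -> 'M[R]_n) N i j :
  measurable_mx F ->
  measurable_fun [set: T'] (fun t => chi N (F t) * K (F t) i j).
Proof.
move=> mF; apply: measurable_funM; first exact: measurable_truncation.
by have := measurable_cross_form _ _ _ _ A (invmx C) F mF i j.
Qed.

Let autocorrE i j : C i j = \int[P]_w (b w i 0 * b w j 0).
Proof. by rewrite mxE unlock. Qed.

Let autocorr_sym : C^T = C.
Proof.
by apply/matrixP => i j; rewrite mxE !autocorrE; apply: eq_Rintegral => w _;
  rewrite mulrC.
Qed.

(** The symmetry hypothesis concerns centered matrices, so it is applied to [g] precomposed with
    translation by [A]. Measurability of [g] is asked along every measurable map because it is used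
    both on [T] and on [borel_mx]. *)
Lemma same_law_reflect (g : 'M[R]_n -> R) (M : R) :
  (forall d' (T' : measurableType d') (F : T' -> 'M[R]_n),
    measurable_mx F -> measurable_fun [set: T'] (fun t => g (F t))) ->
  (forall Z, `|g Z| <= M) ->
  \int[P]_w g (Ahat w) = \int[P]_w g (A *+ 2 - Ahat w).
Proof.
move=> mg gM.
have mX := mg _ _ _ mAhat.
have mY := mg _ _ _ (measurable_mx_reflect A _ _ _ mAhat).
pose X : {mfun T >-> R} := HB.pack (fun w => g (Ahat w))
  (isMeasurableFun.Build _ _ _ _ _ mX).
pose Y : {mfun T >-> R} := HB.pack (fun w => g (A *+ 2 - Ahat w))
  (isMeasurableFun.Build _ _ _ _ _ mY).
apply: (Rintegral_same_law _ _ _ P X Y); last 2 first.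
- by apply: (bounded_integrable _ _ _ _ _ M) => // w; exact: gM.
- by apply: (bounded_integrable _ _ _ _ _ M) => // w; exact: gM.
move=> B mB; pose h (Z : borel_mx R n n) := g (Z + A).
have mh : measurable_fun setT h.
  apply: mg; apply: measurable_mxD; first exact: measurable_mx_borel.
  exact: measurable_mx_cst.
have := symAhat _ (measurable_mx_borel_preimage _ _ _ h B mh mB).
congr (P _ = P _); apply/funext => w; rewrite /preimage /h /=; last first.
  by rewrite addrAC mulr2n.
by rewrite subrK.
Qed.

(** Translating by [A], symmetry gives the events that [Ahat] and its reflection are singular the
    same probability, namely zero. *)
Lemma reflect_unitmx : {ae P, forall w, A *+ 2 - Ahat w \in unitmx}.
Proof.
have mborel : measurable_mx (fun Z : borel_mx R n n => (Z : 'M[R]_n) + A).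
  apply: measurable_mxD; first exact: measurable_mx_borel.
  exact: measurable_mx_cst.
have mS d' (T' : measurableType d') (F : T' -> 'M[R]_n) :
    measurable_mx F -> measurable [set w | F w \notin unitmx].
  move=> /measurable_unitmx/measurable_neg mF.
  by have := mF measurableT [set true] I; rewrite setTI.
have /symAhat := mS _ _ _ mborel.
set B1 := (X in P X = _); set B2 := (X in _ = P X) => PB.
exists B2; split.
- have -> : B2 = [set w | A *+ 2 - Ahat w \notin unitmx].
    by apply/funext => w; rewrite /B2 /preimage /= addrAC mulr2n.
  exact/mS/measurable_mx_reflect.
- rewrite -PB (_ : B1 = [set w | Ahat w \notin unitmx]).
    apply/negligibleP; first exact: mS.
    by apply: (negligibleS _ uAhat) => w /= /negP.
  by apply/funext => w; rewrite /B1 /preimage /= subrK.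
- by move=> w; rewrite /B2 /preimage /= mulr2n addrAC => /negP.
Qed.

Let integrable_chiK N i j (F : T -> 'M[R]_n) : measurable_mx F ->
  P.-integrable setT (EFin \o (fun w => chi N (F w) * K (F w) i j)).
Proof.
move=> mF; apply: (bounded_integrable _ _ _ _ _ N%:R); first exact: mchiK.
by move=> w; exact: truncated_cross_form_le.
Qed.

Let integrable_truncated_form N (F : T -> 'M[R]_n) : measurable_mx F ->
  P.-integrable setT (EFin \o (fun w => truncated_form N (F w))).
Proof.
move=> mF; do 2!apply: integrable_sumr => ?.
under eq_fun do rewrite mulrC.
exact: (integrableZl measurableT _ (integrable_chiK _ _ _ _ mF)).
Qed.

Lemma truncated_form_ge0 N : 0 <= \int[P]_w truncated_form N (Ahat w).
Proof.
have mAhat' := measurable_mx_reflect A _ _ _ mAhat.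
(* Double the integral and replace the second copy by its reflection, so that the integrand becomes
   pointwise nonnegative. *)
rewrite -(pmulrn_lge0 _ (ltn0Sn 1)) mulr2n.
rewrite [X in _ <= _ + X](same_law_reflect _
  (\sum_i \sum_j N%:R * `|C i j|)); last 2 first.
- move=> d' T' F mF; do 2!apply: measurable_sum => ?.
  by apply: measurable_funM => //; exact: mchiK.
- move=> Z; do 2!(apply: (le_trans (ler_norm_sum _ _ _)); apply: ler_sum => ? _).
  by rewrite normrM ler_wpM2r// truncated_cross_form_le.
rewrite -RintegralD//; [|exact: integrable_truncated_form..].
apply: Rintegral_ge0 => w _; rewrite /truncated_form.
have formE Z : \sum_i \sum_j chi N Z * K Z i j * C i j =
    chi N Z * \sum_i \sum_j K Z i j * C i j.
  by do 2!(rewrite mulr_sumr; apply: eq_bigr => ? _); rewrite mulrA.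
(* Invariance lets the truncation factor out of both terms; where it is nonzero, both matrices are
   invertible and the trace inequality applies. *)
rewrite !formE {2}/chi truncation_reflect -mulrDr /chi /truncation.
case: and3P => [[uZ uZ' _]|_]; last by rewrite mul0r.
by rewrite mul1r cross_form_reflect_ge0.
Qed.

(** The truncated factor in [Ahat] is bounded, so its product with [b w i 0 * b w j 0] is
    integrable, and independence replaces the latter by its mean [C i j]. *)
Lemma truncated_cross_term N :
  \int[P]_w (chi N (Ahat w) * cross_term w) =
  \int[P]_w truncated_form N (Ahat w).
Proof.
have ichiK i j := integrable_chiK N i j _ mAhat.
have iprod i j : P.-integrable setT (EFin \o
    (fun w => (chi N (Ahat w) * K (Ahat w) i j) * (b w i 0 * b w j 0))).
  apply: (@le_integrable _ _ _ P _ measurableT _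
      (fun w => N%:R%:E * (b w i 0 * b w j 0)%:E)%E).
  - apply/measurable_EFinP; apply: measurable_funM; first exact: mchiK.
    exact: measurable_funM.
  - move=> w _; rewrite /= lee_fin normrM [leRHS]normrM normr_nat.
    by rewrite ler_wpM2r//; exact: truncated_cross_form_le.
  - exact: integrableZl.
transitivity (\int[P]_w \sum_i \sum_j
    ((chi N (Ahat w) * K (Ahat w) i j) * (b w i 0 * b w j 0))).
  apply: eq_Rintegral => w _; rewrite /cross_term.
  by do 2!(rewrite mulr_sumr; apply: eq_bigr => ? _); rewrite mulrA.
rewrite /truncated_form !Rintegral_sum; last 2 first.
- move=> i; apply: integrable_sumr => j; under eq_fun do rewrite mulrC.
  exact: (integrableZl measurableT _ (ichiK _ _)).
- by move=> i; exact: integrable_sumr.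
apply: eq_bigr => i _; rewrite !Rintegral_sum//; last first.
  move=> j; under eq_fun do rewrite mulrC.
  exact: (integrableZl measurableT _ (ichiK _ _)).
apply: eq_bigr => j _; rewrite RintegralZr// autocorrE.
have mX := mchiK _ _ _ N i j mAhat.
have mY : measurable_fun setT (fun w => b w i 0 * b w j 0).
  exact: measurable_funM.
pose X : {mfun T >-> R} := HB.pack (fun w => chi N (Ahat w) * K (Ahat w) i j)
  (isMeasurableFun.Build _ _ _ _ _ mX).
pose Y : {mfun T >-> R} := HB.pack (fun w => b w i 0 * b w j 0)
  (isMeasurableFun.Build _ _ _ _ _ mY).
apply: (Rintegral_mul_indep P X Y); last 3 first.
- exact: ichiK.
- exact: intbb.
- exact: iprod.
move=> B1 B2 mB1 mB2; apply: (Ahat_b_indep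
    ((fun Z => chi N Z * K Z i j) @^-1` B1)
    ((fun v : 'cV_n => v i 0 * v j 0) @^-1` B2)).
  apply: (measurable_mx_borel_preimage _ _ _
    (fun Z => chi N Z * K Z i j) B1) => //.
  by apply: mchiK; exact: measurable_mx_borel.
apply: (measurable_mx_borel_preimage _ _ _
  (fun v => v i 0 * v j 0) B2) => //.
by apply: measurable_funM; exact: measurable_mx_borel.
Qed.

Lemma measurable_cross_term : measurable_fun setT cross_term.
Proof.
do 2!apply: measurable_sum => ?; apply: measurable_funM.
  exact: measurable_cross_form.
exact: measurable_funM.
Qed.

Lemma Rintegral_cross_term_ge0 :
  P.-integrable setT (EFin \o cross_term) -> 0 <= \int[P]_w cross_term w.
Proof.
move=> icross.
have mchi N : measurable_fun setT (fun w => chi N (Ahat w)).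
  exact: measurable_truncation.
have mchic N : measurable_fun setT (fun w => chi N (Ahat w) * cross_term w).
  by apply: measurable_funM => //; exact: measurable_cross_term.
have chic_le N w : `|chi N (Ahat w) * cross_term w| <= `|cross_term w|.
  rewrite normrM ger0_norm; last exact: truncation_ge0.
  by rewrite ler_piMl//; exact: truncation_le1.
(* The truncated cross terms are dominated by [|cross_term|]. Almost surely [Ahat] and its
   reflection are both invertible, and the truncation equals 1 as soon as [N] exceeds
   [cross_size]. *)
have [||||//|_ _] := @dominated_convergence _ _ _ P _ measurableT
  (fun N w => (chi N (Ahat w) * cross_term w)%:E) (EFin \o cross_term)
  (abse \o (EFin \o cross_term)).
- by move=> N; exact/measurable_EFinP.
- by apply/measurable_EFinP; exact: measurable_cross_term.
- apply: filterS2 uAhat reflect_unitmx => w uw u'w _.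
  apply: cvg_near_cst; near=> N.
  rewrite /chi /truncation uw u'w /=.
  have -> : cross_size A (invmx C) (Ahat w) <= N%:R.
    by near: N; exact: nbhs_infty_ger.
  by rewrite mul1r.
- exact: integrable_abse.
- by apply: aeW => w N _; rewrite /= lee_fin.
move=> chi_cvg; rewrite -lee_fin /Rintegral fineK; last exact: integrable_fin_num.
rewrite -(cvg_lim _ chi_cvg)//; apply: lime_ge.
  by apply/cvg_ex; eexists; exact: chi_cvg.
apply: nearW => N; rewrite -[leRHS]fineK.
  by rewrite lee_fin -/(Rintegral _ _ _) truncated_cross_term truncated_form_ge0.
apply: integrable_fin_num => //; apply: le_integrable icross => //.
  by apply/measurable_EFinP.
by move=> w _; rewrite /= lee_fin.
Unshelve. all: by end_near.
Qed.

End cross_term.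

(** * The residual error as a quadratic polynomial in [beta] *)

Section quadratic.
Context {R : realType} {n : nat}.
Implicit Types (A S Z : 'M[R]_n) (v : 'cV[R]_n).

Lemma wnorm2_gram A v : wnorm2 (A^T *m A) v = \sum_i (A *m v) i 0 ^+ 2.
Proof.
rewrite /wnorm2 !mulmxA -trmx_mul -mulmxA mxE.
by apply: eq_bigr => i _; rewrite mxE.
Qed.

(** Multiplying by [A] turns the residual into [u - beta v], and the [A^T A] norm into the Euclidean
    one. *)
Lemma aug_inv_residual A S Z v (beta : R) : A \in unitmx ->
  A *m ((aug_inv Z S beta - invmx A) *m v) =
  (A *m invmx Z - 1%:M) *m v - beta *: (A *m invmx Z *m invmx S *m v).
Proof.
move=> uA; rewrite mulmxA mulmxBr mulmxV// mulmxBr -scalemxAr mulmxA.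
by rewrite addrAC mulmxBl -scalemxAl.
Qed.

Lemma cross_form_bilin A S Z v :
  \sum_i \sum_j cross_form A S Z i j * (v i 0 * v j 0) =
  \sum_i (A *m invmx Z *m S *m v) i 0 * ((A *m invmx Z - 1%:M) *m v) i 0.
Proof.
transitivity ((v^T *m cross_form A S Z *m v) 0 0); last first.
  rewrite /cross_form mulmxA -trmx_mul -mulmxA mxE.
  by apply: eq_bigr => i _; rewrite mxE.
rewrite mxE exchange_big; apply: eq_bigr => j _ /=.
rewrite mxE mulr_suml; apply: eq_bigr => i _.
by rewrite [v^T _ _]mxE; ring.
Qed.

Lemma wnorm2_aug_inv A S Z v (beta : R) : A \in unitmx ->
  wnorm2 (A^T *m A) ((aug_inv Z S beta - invmx A) *m v) =
  \sum_i ((A *m invmx Z - 1%:M) *m v) i 0 ^+ 2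
  - 2 * beta * (\sum_i \sum_j cross_form A (invmx S) Z i j * (v i 0 * v j 0))
  + beta ^+ 2 * \sum_i (A *m invmx Z *m invmx S *m v) i 0 ^+ 2.
Proof.
move=> uA; rewrite wnorm2_gram aug_inv_residual// cross_form_bilin.
move: (_ *m v) (_ *m v) => x y.
rewrite !mulr_sumr -sumrB -big_split /=; apply: eq_bigr => i _.
by rewrite !mxE; ring.
Qed.

End quadratic.

(** * The sign of the minimizer *)

Theorem theorem7p1 (d : measure_display) (T : measurableType d)
  (R : realType) (P : probability T R) (n : nat) (n_gt0 : (0 < n)%N)
  (A : 'M[R]_n) (Ahat : T -> 'M[R]_n) (b : T -> 'cV[R]_n) :
  A \in unitmx ->
  random_mx Ahat ->
  {ae P, forall w, Ahat w \in unitmx} ->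
  (* E[Ahat^-2] exists *)
  (forall i j, P.-integrable setT
     (fun w => ((invmx (Ahat w) *m invmx (Ahat w)) i j)%:E)) ->
  (* E[Ahat] = A *)
  (forall i j, P.-integrable setT (fun w => (Ahat w i j)%:E) /\
     ('E_P[(fun w => Ahat w i j)%R] = (A i j)%:E)%E) ->
  (* symmetry about the mean: Ahat - A and A - Ahat have the same law *)
  same_distr P (fun w => Ahat w - A) (fun w => A - Ahat w) ->
  random_mx b ->
  indep_mx P Ahat b ->
  (* R = E[b b^T] exists and is nonsingular *)
  (forall i j, P.-integrable setT (fun w => (b w i 0 * b w j 0)%:E)) ->
  autocorr P b \in unitmx ->
  (* E(beta) is a well-defined real number for every beta *)
  (forall beta : R, semiBayes_err P A Ahat b beta \is a fin_num) ->
  forall beta_star : R,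
    (forall beta : R,
       (semiBayes_err P A Ahat b beta_star <= semiBayes_err P A Ahat b beta)%E) ->
    0 <= beta_star.
Proof.
move=> uA rAhat uAhat _ _ symAhat rb indAb intbb uC finE beta_star min_beta.
have mAhat := random_mx_measurable _ _ _ _ _ _ rAhat.
have mb := random_mx_measurable _ _ _ _ _ _ rb.
set C := autocorr P b in uC *.
pose err beta w := wnorm2 (A^T *m A)
  ((aug_inv (Ahat w) C beta - invmx A) *m b w).
(* Pointwise, [q0], [q1] and [q2] are [|u|^2], [<v, u>] and [|v|^2]. *)
pose q0 w := \sum_i ((A *m invmx (Ahat w) - 1%:M) *m b w) i 0 ^+ 2.
pose q1 := cross_term P A Ahat b.
pose q2 w := \sum_i (A *m invmx (Ahat w) *m invmx C *m b w) i 0 ^+ 2.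
have errE beta w : err beta w = q0 w - 2 * beta * q1 w + beta ^+ 2 * q2 w.
  exact: wnorm2_aug_inv.
have err_ge0 beta w : 0 <= err beta w.
  by rewrite /err wnorm2_gram; apply: sumr_ge0 => i _; exact: sqr_ge0.
have mM : measurable_mx (fun w => A *m invmx (Ahat w)).
  by apply: measurable_mulmx; [exact: measurable_mx_cst|exact: measurable_invmx].
have mv : measurable_mx (fun w => A *m invmx (Ahat w) *m invmx C *m b w).
  apply: measurable_mulmx => //; apply: measurable_mulmx => //.
have mq0 : measurable_fun setT q0.
  apply: measurable_sum => i; apply: measurable_funX.
  have /(_ i 0) // : measurable_mx (fun w => (A *m invmx (Ahat w) - 1%:M) *m b w).
  by apply: measurable_mulmx => //; apply: measurable_mxB.
have mq1 : measurable_fun setT q1 by exact: measurable_cross_term.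
have mq2 : measurable_fun setT q2.
  by apply: measurable_sum => i; apply: measurable_funX; exact: mv.
have ierr beta : P.-integrable setT (EFin \o err beta).
  apply: ge0_fin_num_integrable => //.
    rewrite (funext (errE beta)); apply: measurable_funD.
      by apply: measurable_funB => //; exact: measurable_funM.
    exact: measurable_funM.
  by have := finE beta; rewrite /semiBayes_err unlock.
(* Finiteness is given only for the whole error, so each coefficient is recovered by interpolation
   from its values at [-1], [0] and [1]. *)
have iq0 : P.-integrable setT (EFin \o q0).
  have := ierr 0; congr (_.-integrable _ _); apply/funext => w /=.
  by rewrite errE; congr EFin; ring.
have iq1 : P.-integrable setT (EFin \o q1).
  have := integrableZl measurableT 4^-1 (integrableB measurableT (ierr (-1)) (ierr 1)).
  congr (_.-integrable _ _); apply/funext => w /=.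
  by rewrite -EFinB -EFinM !errE; congr EFin; field.
have iq2 : P.-integrable setT (EFin \o q2).
  have := integrableZl measurableT 2^-1 (integrableB measurableT
    (integrableD measurableT (ierr (-1)) (ierr 1))
    (integrableZl measurableT 2 iq0)).
  congr (_.-integrable _ _); apply/funext => w /=.
  by rewrite !(=^~ EFinD, =^~ EFinM, =^~ EFinN) !errE; congr EFin; field.
have bayesE beta : semiBayes_err P A Ahat b beta =
    (\int[P]_w q0 w - 2 * beta * \int[P]_w q1 w + beta ^+ 2 * \int[P]_w q2 w)%:E.
  have iq1' : P.-integrable setT (EFin \o (fun w => 2 * beta * q1 w)).
    exact: (integrableZl measurableT (2 * beta) iq1).
  have iq2' : P.-integrable setT (EFin \o (fun w => beta ^+ 2 * q2 w)).
    exact: (integrableZl measurableT (beta ^+ 2) iq2).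
  rewrite -!RintegralZl// -RintegralB// -RintegralD//; 
    last exact: (integrableB measurableT iq0 iq1').
  under eq_Rintegral do rewrite -errE.
  rewrite /Rintegral fineK; last by apply: integrable_fin_num => //; exact: ierr.
  by rewrite /semiBayes_err unlock.
have q1_ge0 : 0 <= \int[P]_w q1 w by exact: Rintegral_cross_term_ge0.
have q2_pt_ge0 w : 0 <= q2 w by apply: sumr_ge0 => i _; exact: sqr_ge0.
have q2_gt0 : 0 < \int[P]_w q2 w.
  (* If [E|v|^2] were zero, [v] would vanish almost surely, hence also [b], its image under an
     invertible matrix; then [C] would be zero, which is singular since [n > 0]. *)
  rewrite lt_def Rintegral_ge0// andbT; apply/negP => /eqP q2_0.
  have q2_ae0 : ae_eq P setT (EFin \o q2) (cst 0%E).
    apply/(ae_eq_integral_abs P measurableT); first exact/measurable_EFinP.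
    under eq_integral do rewrite /= ger0_norm//.
    by rewrite -[LHS]fineK ?integrable_fin_num// -/(Rintegral _ _ _) q2_0.
  have b_ae0 : {ae P, forall w, b w = 0}.
    apply: filterS2 uAhat q2_ae0 => w uw /(_ I) [/eqP].
    rewrite psumr_eq0 => [/allP v0|i _]; last exact: sqr_ge0.
    have : A *m invmx (Ahat w) *m invmx C *m b w = 0.
      apply/matrixP => i j; rewrite ord1 [RHS]mxE; apply/eqP.
      by have := v0 i (mem_index_enum i); rewrite sqrf_eq0.
    (* The multiplier is the inverse of [A Ahat^-1 C^-1]. *)
    rewrite -!mulmxA => /(congr1 (mulmx (C *m Ahat w *m invmx A))).
    by rewrite mulmx0 -!mulmxA mulKmx// mulKVmx// mulKVmx.
  have C0 : C = 0.
    apply/matrixP => i j; rewrite !mxE unlock.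
    rewrite (ae_eq_integral (cst 0%E)) ?integral0//.
      exact: (measurable_int _ (intbb i j)).
    by apply: filterS b_ae0 => w bw0 _; rewrite bw0 !mxE mul0r.
  have := mulmxV uC; rewrite C0 mul0mx => /matrixP/(_ (Ordinal n_gt0) (Ordinal n_gt0)).
  by rewrite !mxE eqxx => /eqP; rewrite eq_sym oner_eq0.
(* Comparison with [beta = 0] gives [beta_star^2 E|v|^2 <= 2 beta_star E<v, u>]; for negative
   [beta_star] the left side is positive and the right side is not. *)
rewrite leNgt; apply/negP => beta_lt0; have := min_beta 0.
rewrite !bayesE lee_fin.
have : 0 < beta_star ^+ 2 * \int[P]_w q2 w.
  by rewrite mulr_gt0// exprn_even_gt0//= lt_eqF.
have : beta_star * \int[P]_w q1 w <= 0 by rewrite nmulr_rle0.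
by move: (\int[P]_w q0 w) (\int[P]_w q1 w) (\int[P]_w q2 w) => e0 e1 e2; lra.
Qed.
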